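(* Assume $\operatorname{rank}(V_{N,r})=R$ and $\operatorname{rank}(V_{M,r})=M$. Let $Q\in\mathbb{R}^{3\times3}$ be an orthogonal matrix such that $$QX_N=X_N,\qquad QX_M=X_M.$$ For any function $g:\mathbb{S}^2\to\mathbb{R}$, define $g^{Q}:=g\circ Q^{-1}$. Then, for any function $f:\mathbb{S}^2\to\mathbb{R}$, $$\hat p_r[f^{Q}]=(\hat p_r[f])^{Q}.$$ In other words, the interpolation--regression operator on the sphere is equivariant with respect to every orthogonal symmetry preserving both $X_N$ and $X_M$.
   Context: $\Pi_r(\mathbb{S}^2)$ is the space of spherical polynomials of degree at most $r$ on the unit sphere $\mathbb{S}^2\subset\mathbb{R}^3$, of dimension $R=(r+1)^2$. $X_N=\{\boldsymbol{x}_1,\dots,\boldsymbol{x}_N\}\subset\mathbb{S}^2$ is a set of $N$ distinct sampling nodes and $X_M=\{\boldsymbol{x}_1',\dots,\boldsymbol{x}_M'\}\subset X_N$ a subset of $M$ distinct interpolation nodes. Conventions: $N=(n+1)^2$, $M=(m+1)^2$, with integers $0\le m<r<n$. For a fixed basis $\{b_1,\dots,b_R\}$ of $\Pi_r(\mathbb{S}^2)$, $V_{N,r}=[b_j(\boldsymbol{x}_i)]\in\mathbb{R}^{N\times R}$ and $V_{M,r}=[b_j(\boldsymbol{x}_i')]\in\mathbb{R}^{M\times R}$. For a $3\times 3$ matrix $Q$, $QX_N=\{Q\boldsymbol{x}_i: i=1,\dots,N\}$ and $QX_M=\{Q\boldsymbol{x}_j': j=1,\dots,M\}$. For $f:\mathbb{S}^2\to\mathbb{R}$,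 the interpolation--regression approximant $\hat p_r[f]$ is the (under the rank assumptions, unique) minimizer of $\sum_{i=1}^N|p(\boldsymbol{x}_i)-f(\boldsymbol{x}_i)|^2$ over all $p\in\Pi_r(\mathbb{S}^2)$ subject to $p(\boldsymbol{x}_j')=f(\boldsymbol{x}_j')$, $j=1,\dots,M$. *)

(* Defs.v *)
From HB Require Import structures.
From mathcomp Require Import all_boot all_order all_algebra.
From mathcomp Require Import boolp classical_sets reals.
From mathcomp Require Import mpoly.
Set Implicit Arguments.
Unset Strict Implicit.
Unset Printing Implicit Defensive.
Import Order.TTheory GRing.Theory Num.Theory.
Local Open Scope classical_set_scope.
Local Open Scope ring_scope.

Record sphere (R : realType) := Sphere {
  sphere_val : 'cV[R]_3;
  sphereP : \sum_(i < 3) sphere_val i 0 ^+ 2 == 1 }.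

HB.instance Definition _ (R : realType) := [isSub for @sphere_val R].

Definition orthogonalmx (R : realType) (n : nat) :=
  [qualify Q : 'M[R]_n | Q *m Q^T == 1%:M].

Lemma orthogonalmx_unit (R : realType) (n : nat) (Q : 'M[R]_n) :
  Q \is @orthogonalmx R n -> Q \in unitmx.
Proof. by move=> /eqP /mulmx1_unit[]. Qed.

Lemma orthogonalmx_inv (R : realType) (n : nat) (Q : 'M[R]_n) :
  Q \is @orthogonalmx R n -> invmx Q \is @orthogonalmx R n.
Proof.
move=> QO; have uQ := orthogonalmx_unit QO; move/eqP: QO => QQt.
have -> : invmx Q = Q^T by rewrite -[LHS]mulmx1 -QQt mulKmx.
by rewrite qualifE /= trmxK; apply/eqP/mulmx1C.
Qed.

Lemma sphere_mul_subproof (R : realType) (Q : 'M[R]_3)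
    (hQ : Q \is @orthogonalmx R 3) (x : sphere R) :
  \sum_(i < 3) (Q *m val x) i 0 ^+ 2 == 1.
Proof.
have sqE (u : 'cV[R]_3) : \sum_(i < 3) u i 0 ^+ 2 = (u^T *m u) 0 0.
  by rewrite mxE; apply: eq_bigr => i _; rewrite mxE expr2.
move/eqP: hQ => /mulmx1C QtQ.
by rewrite sqE trmx_mul mulmxA -(mulmxA _ Q^T) QtQ mulmx1 -sqE (valP x).
Qed.

Definition sphere_mul (R : realType) (Q : 'M[R]_3)
    (hQ : Q \is @orthogonalmx R 3) (x : sphere R) : sphere R :=
  Sphere (sphere_mul_subproof hQ x).

(* g^Q = g \o Q^-1 *)
Definition sphere_transport (R : realType) (Q : 'M[R]_3)
    (hQ : Q \is @orthogonalmx R 3) (g : sphere R -> R) : sphere R -> R :=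
  g \o sphere_mul (orthogonalmx_inv hQ).

(* Restrictions to the sphere of trivariate polynomials of total degree at most
   r; recall that msize q is the total degree of q plus one (and 0 if q = 0). *)
Definition spherical_poly (R : realType) (r : nat) : set (sphere R -> R) :=
  [set p | exists2 q : {mpoly R[3]}, (msize q <= r.+1)%N &
             forall x : sphere R, p x = q.@[fun i => val x i 0]].

Definition is_basis_of (R : realType) (T : Type) (k : nat)
    (E : set (T -> R)) (b : 'I_k -> T -> R) : Prop :=
  [/\ forall j, E (b j),
      forall c : 'I_k -> R,
        (forall x, \sum_(j < k) c j * b j x = 0) -> forall j, c j = 0
    & forall p, E p ->
        exists c : 'I_k -> R, forall x, p x = \sum_(j < k) c j * b j x].

Definition sample_mx (R : realType) (T : Type) (n k : nat)
    (b : 'I_k -> T -> R) (x : 'I_n -> T) : 'M[R]_(n, k) :=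
  \matrix_(i < n, j < k) b j (x i).

Section InterpolationRegression.
Variables (R : realType) (r N M : nat).
Variables (xN : 'I_N -> sphere R) (xM : 'I_M -> sphere R).

Definition ir_feasible (f : sphere R -> R) : set (sphere R -> R) :=
  [set p | spherical_poly r p /\ forall j, p (xM j) = f (xM j)].

Definition ir_residual (f p : sphere R -> R) : R :=
  \sum_(i < N) `|p (xN i) - f (xN i)| ^+ 2.

Definition ir_minimizer (f : sphere R -> R) : set (sphere R -> R) :=
  [set p | ir_feasible f p /\
           forall q, ir_feasible f q -> ir_residual f p <= ir_residual f q].

(* The minimizer, chosen classically. The default value 0 is used only when
   there is no minimizer; when the matrices of xN and xM in a basis of
   spherical_poly r have full column and full row rank respectively, the
   minimizer exists and is unique. *)
Definition ir_approx (f : sphere R -> R) : sphere R -> R :=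
  xget (fun=> 0) (ir_minimizer f).

End InterpolationRegression.

(* Main.v *)
(** A symmetry of both node families maps the minimizers for [f] bijectively onto
    the minimizers for [f^Q]: it preserves the space of spherical polynomials and
    the interpolation constraints, and it merely permutes the terms of the
    residual. The minimizer is unique by the parallelogram law, since a spherical
    polynomial vanishing on all sampling nodes is zero. Existence of a minimizer
    plays no role: the default value 0 of [ir_approx] is itself invariant. *)
Require Import Defs.
From mathcomp Require Import all_boot all_order all_algebra.
From mathcomp Require Import boolp classical_sets reals.
From mathcomp Require Import mpoly ring lra.
Set Implicit Arguments.
Unset Strict Implicit.
Unset Printing Implicit Defensive.
Import Order.TTheory GRing.Theory Num.Theory.
Local Open Scope classical_set_scope.
Local Open Scope ring_scope.

Lemma msizeM_pred_le (R : idomainType) (n : nat) (p q : {mpoly R[n]}) :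
  (msize (p * q) <= (msize p + msize q).-1)%N.
Proof.
have [->|p0] := eqVneq p 0; first by rewrite mul0r msize0.
have [->|q0] := eqVneq q 0; first by rewrite mulr0 msize0.
by rewrite msizeM.
Qed.

Lemma msizeX_affine_le (R : idomainType) (n k : nat) (p : {mpoly R[n]}) :
  (msize p <= 2)%N -> (msize (p ^+ k) <= k.+1)%N.
Proof.
move=> hp; elim: k => [|k IH]; first by rewrite expr0 msize1.
rewrite exprS (leq_trans (msizeM_pred_le _ _)) //.
by rewrite -subn1 leq_subLR; exact: leq_add hp IH.
Qed.

(** A monomial of degree d turns into a product of d factors of degree at most one, so no monomial
    gains degree. *)
Lemma msize_comp_affine_le (R : idomainType) (n k : nat) (p : {mpoly R[n]})
    (lq : n.-tuple {mpoly R[k]}) :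
  (forall i, (msize (tnth lq i) <= 2)%N) -> (msize (p \mPo lq) <= msize p)%N.
Proof.
move=> hlq; rewrite comp_mpolyE (leq_trans (msize_sum _ _ _)) //.
apply/bigmax_leqP_seq => m mp _.
apply: (leq_trans (msizeZ_le _ _)); apply: (leq_trans _ (msize_mdeg_lt mp)).
rewrite mdegE; elim/big_rec2: _ => [|i e q _ hq]; first by rewrite msize1.
apply: (leq_trans (msizeM_pred_le _ _)).
rewrite -subn1 leq_subLR (leq_trans (leq_add (msizeX_affine_le _ (hlq i)) hq)) //.
by rewrite addSn addnS.
Qed.

Section SphericalPoly.
Variables (R : realType) (r : nat).
Implicit Types p q : sphere R -> R.

Lemma spherical_polyD p q :
  spherical_poly r p -> spherical_poly r q -> spherical_poly r (p \+ q).
Proof.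
move=> [P hP pE] [P' hP' qE]; exists (P + P').
  by rewrite (leq_trans (msizeD_le _ _)) // geq_max hP.
by move=> x; rewrite mevalD -pE -qE.
Qed.

Lemma spherical_polyZ (c : R) p :
  spherical_poly r p -> spherical_poly r (fun x => c * p x).
Proof.
move=> [P hP pE]; exists (c *: P); first exact: leq_trans (msizeZ_le _ _) hP.
by move=> x; rewrite mevalZ -pE.
Qed.

Lemma spherical_poly_mul (Q : 'M[R]_3) (hQ : Q \is @orthogonalmx R 3) p :
  spherical_poly r p -> spherical_poly r (p \o sphere_mul hQ).
Proof.
move=> [P hP pE].
(* The i-th substituted linear form computes the i-th coordinate of [Q *m x]. *)
exists (P \mPo [tuple \sum_(j < 3) Q i j *: 'X_j | i < 3]).
  apply: leq_trans hP; apply: msize_comp_affine_le => i; rewrite tnth_mktuple.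
  rewrite (leq_trans (msize_sum _ _ _)) //; apply/bigmax_leqP => j _.
  by rewrite (leq_trans (msizeZ_le _ _)) // msizeX mdeg1.
move=> x; rewrite /= pE comp_mpoly_meval; apply: meval_eq => i.
rewrite tnth_mktuple mxE raddf_sum; apply: eq_bigr => j _ /=.
by rewrite mevalZ mevalXU.
Qed.

Lemma spherical_poly_eq (N k : nat) (b : 'I_k -> sphere R -> R)
    (x : 'I_N -> sphere R) p q :
  is_basis_of (@spherical_poly R r) b -> \rank (sample_mx b x) = k ->
  spherical_poly r p -> spherical_poly r q ->
  (forall i, p (x i) = q (x i)) -> p = q.
Proof.
move=> [_ _ bE] rk /bE[c pE] /bE[d qE] eqpq.
suff cd : \col_j c j = \col_j d j :> 'cV[R]_k.
  apply/funext => y; rewrite pE qE; apply: eq_bigr => j _.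
  by move/colP/(_ j): cd; rewrite !mxE => ->.
(* Rank [k] is full column rank, so the values at the nodes determine the coefficient vector. *)
apply: (@row_full_inj _ _ _ _ (sample_mx b x)); first by apply/eqP.
apply/colP => i; rewrite !mxE; move: (eqpq i); rewrite pE qE => pq.
by under eq_bigr do rewrite !mxE mulrC; under [RHS]eq_bigr do rewrite !mxE mulrC.
Qed.

End SphericalPoly.

Lemma sphere_mulVK (R : realType) (Q : 'M[R]_3) (hQ : Q \is @orthogonalmx R 3) :
  cancel (sphere_mul (orthogonalmx_inv hQ)) (sphere_mul hQ).
Proof. by move=> x; apply/val_inj; rewrite /= mulKVmx ?orthogonalmx_unit. Qed.

Lemma sphere_mulKV (R : realType) (Q : 'M[R]_3) (hQ : Q \is @orthogonalmx R 3) :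
  cancel (sphere_mul hQ) (sphere_mul (orthogonalmx_inv hQ)).
Proof. by move=> x; apply/val_inj; rewrite /= mulKmx ?orthogonalmx_unit. Qed.

Section Minimizers.
Variables (R : realType) (r N M : nat).
Variables (xN : 'I_N -> sphere R) (xM : 'I_M -> sphere R).
Implicit Types f p q : sphere R -> R.

Lemma ir_minimizer_uniq (k : nat) (b : 'I_k -> sphere R -> R) f p q :
  is_basis_of (@spherical_poly R r) b -> \rank (sample_mx b xN) = k ->
  ir_minimizer r xN xM f p -> ir_minimizer r xN xM f q -> p = q.
Proof.
move=> hb rk [[pr pf] pmin] [[qr qf] qmin].
apply: (spherical_poly_eq hb rk) => //.
(* The midpoint of two minimizers is feasible because the constraints are affine. *)
pose h : sphere R -> R := fun x => 2^-1 * (p \+ q) x.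
have hh : ir_feasible r xM f h.
  split; first exact/spherical_polyZ/spherical_polyD.
  by move=> j; rewrite /h /= pf qf; lra.
have parallelogram : \sum_(i < N) (p (xN i) - q (xN i)) ^+ 2 =
    2 * ir_residual xN f p + 2 * ir_residual xN f q - 4 * ir_residual xN f h.
  rewrite /ir_residual !mulr_sumr -big_split -sumrB /=; apply: eq_bigr => i _.
  by rewrite !real_normK ?num_real // /h /=; field.
have sum0 : \sum_(i < N) (p (xN i) - q (xN i)) ^+ 2 = 0.
  apply/le_anti/andP; split; last by apply: sumr_ge0 => i _; exact: sqr_ge0.
  rewrite parallelogram.
  (* Neither minimal residual exceeds that of [h], so the right-hand side is at most 0. *)
  by move: (pmin _ hh) (qmin _ hh); lra.
move=> i; apply/eqP; rewrite -subr_eq0 -sqrf_eq0.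
by rewrite (psumr_eq0P _ sum0) // => j _; exact: sqr_ge0.
Qed.

Lemma ir_residual_comp (S : sphere R -> sphere R) f p :
  injective xN -> injective S -> (forall i, range xN (S (xN i))) ->
  ir_residual xN (f \o S) (p \o S) = ir_residual xN f p.
Proof.
move=> xN_inj S_inj SN.
(* [s] is the index map with [xN (s i) = S (xN i)]; being injective on a finite type, it is a
   permutation. *)
have [s _ sE] := all_sig2 (fun i => cid2 (SN i)).
have s_inj : injective s.
  by move=> i j ij; apply/xN_inj/S_inj; rewrite -!sE ij.
rewrite /ir_residual [RHS](reindex_inj s_inj).
by apply: eq_bigr => i _; rewrite /= sE.
Qed.

Lemma ir_minimizer_comp (S T : sphere R -> sphere R) f p :
  cancel S T -> cancel T S -> injective xN ->
  (forall q, spherical_poly r q -> spherical_poly r (q \o S)) ->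
  (forall q, spherical_poly r q -> spherical_poly r (q \o T)) ->
  S @` range xN = range xN -> S @` range xM = range xM ->
  ir_minimizer r xN xM f p -> ir_minimizer r xN xM (f \o S) (p \o S).
Proof.
move=> SK TK xN_inj polyS polyT SN SM [[pr pf] pmin].
have SxN i : range xN (S (xN i)) by rewrite -SN; exists (xN i); first exists i.
have SxM j : range xM (S (xM j)) by rewrite -SM; exists (xM j); first exists j.
have TxM j : range xM (T (xM j)).
  have : range xM (xM j) by exists j.
  by rewrite -{1}SM => -[y ry <-]; rewrite SK.
have resE := ir_residual_comp _ _ xN_inj (can_inj SK) SxN.
split.
  split; first exact: polyS.
  by move=> j /=; case: (SxM j) => k _ <-.
move=> q [qr qf]; rewrite resE.
(* A competitor [q] for [f \o S] is the transport of the competitor [q \o T] for [f], with the same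
   residual. *)
have -> : q = (q \o T) \o S by apply/funext => x /=; rewrite SK.
rewrite resE; apply: pmin; split; first exact: polyT.
(* With [T (xM j) = xM k], the constraint on [q] at [xM k] reads
   [q (T (xM j)) = f (S (xM k)) = f (xM j)]. *)
by move=> j /=; case: (TxM j) (TK (xM j)) => k _ <- <-; rewrite qf.
Qed.

End Minimizers.

Theorem theorem6 (R : realType) (m r n : nat) (hmr : (m < r)%N) (hrn : (r < n)%N)
  (xN : 'I_((n.+1 ^ 2)%N) -> sphere R) (xN_inj : injective xN)
  (xM : 'I_((m.+1 ^ 2)%N) -> sphere R) (xM_inj : injective xM)
  (xM_sub : range xM `<=` range xN)
  (b : 'I_((r.+1 ^ 2)%N) -> sphere R -> R)
  (b_basis : is_basis_of (@spherical_poly R r) b)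
  (rankN : \rank (sample_mx b xN) = (r.+1 ^ 2)%N)
  (rankM : \rank (sample_mx b xM) = (m.+1 ^ 2)%N)
  (Q : 'M[R]_3) (hQ : Q \is @orthogonalmx R 3)
  (hQN : sphere_mul hQ @` range xN = range xN)
  (hQM : sphere_mul hQ @` range xM = range xM)
  (f : sphere R -> R) :
  ir_approx r xN xM (sphere_transport hQ f) =
  sphere_transport hQ (ir_approx r xN xM f).
Proof.
have polyS q := @spherical_poly_mul R r _ (orthogonalmx_inv hQ) q.
have polyT q := @spherical_poly_mul R r _ hQ q.
have SK := sphere_mulVK hQ; have TK := sphere_mulKV hQ.
(* From here on [S] and [T], the actions of the inverse of [Q] and of [Q], are just mutually inverse
   maps preserving spherical polynomials. *)
rewrite /sphere_transport; move: (sphere_mul _) SK TK polyS => S SK TK polyS.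
move: (sphere_mul _) SK TK polyT hQN hQM => T SK TK polyT TN TM.
have invE (A : set (sphere R)) : T @` A = A -> S @` A = A.
  by move=> {1}<-; rewrite image_comp (_ : S \o T = id) ?image_id//; exact/funext.
have fST : (f \o S) \o T = f by apply/funext => x /=; rewrite TK.
have minS := ir_minimizer_comp SK TK xN_inj polyS polyT (invE _ TN) (invE _ TM).
have minT := ir_minimizer_comp TK SK xN_inj polyT polyS TN TM.
rewrite /ir_approx; case: (xgetP _ (ir_minimizer r xN xM f)) => [p _ pmin|fN].
  apply: xget_unique; first exact: minS.
  by move=> q qmin; exact: ir_minimizer_uniq b_basis rankN qmin (minS _ _ pmin).
(* If [f] has no minimizer, neither has [f \o S], since [T] would carry one back; both sides are
   then the zero function. *)
apply: xgetPN => q qmin.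
by apply: (fN (q \o T)); rewrite -fST; exact: minT.
Qed.
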